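(* Let $\mathcal{C}\subseteq\mathbb{R}^n$ be a compact convex set, let $f\colon\mathcal{C}\to\mathbb{R}$ be convex and differentiable in an open set containing $\mathcal{C}$, and let $\eta_t=\frac{\ell}{t+\ell}$ for some integer $\ell\ge 1$ and all $t\in\mathbb{N}$. Suppose that $(\mathcal{C},f)$ satisfies the strong $(M,0)$-growth property for some $M>0$ and the gaps $(m,r)$-growth property for some $m>0$ and $r\in[0,1)$. Let $$S=\min\left\{i\in\mathbb{N},\ i\ge 1\ \Big|\ \eta_iM\le\frac{m^{1/r}}{2^{1/r}}\right\}=\max\left\{1,\left\lceil\frac{2^{1/r}\ell M}{m^{1/r}}-\ell\right\rceil\right\}.$$ Then, for the iterates $(x_t)_{t\in\mathbb{N}}$ of the Frank-Wolfe algorithm with step-sizes $\eta_t$ and all integers $t\ge S$, $$\mathrm{subopt}_t\le\max\left\{\mathrm{subopt}_S\left(\frac{\eta_{t-1}}{\eta_{S-1}}\right)^{\ell},\ \eta_{t-1}^{\min\{\ell,\frac{1}{1-r},2\}}\left(\left(\frac{M}{m}\right)^{\frac{1}{1-r}}+\frac{M}{2}\right)\right\}=\mathcal{O}\left(t^{-\ell}+t^{-\frac{1}{1-r}}+t^{-2}\right).$$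
   Context: $\mathbb{N}=\{0,1,2,\ldots\}$. Frank-Wolfe algorithm for $\min_{x\in\mathcal{C}}f(x)$ with step-sizes $\eta_t\in[0,1]$: given any $x_0\in\mathcal{C}$, for $t=0,1,2,\ldots$ choose any $v_t\in\operatorname{argmin}_{v\in\mathcal{C}}\langle\nabla f(x_t),v-x_t\rangle$ and set $x_{t+1}=x_t+\eta_t(v_t-x_t)$. For $x,y\in\mathcal{C}$: $D_f(y,x)=f(y)-f(x)-\langle\nabla f(x),y-x\rangle$, $\mathrm{subopt}(x)=f(x)-\min_{y\in\mathcal{C}}f(y)$, and $\mathrm{gap}(x)=\max_{v\in\mathcal{C}}\langle\nabla f(x),x-v\rangle$. For the iterates, $\mathrm{subopt}_t=\mathrm{subopt}(x_t)$. Strong $(M,0)$-growth property: for all $x\in\mathcal{C}$ and all $v\in\operatorname{argmin}_{y\in\mathcal{C}}\langle\nabla f(x),y-x\rangle$, $D_f(x+\eta(v-x),x)\le\frac{M\eta^2}{2}$ for all $\eta\in[0,1]$. Gaps $(m,r)$-growth property: $m\cdot\mathrm{subopt}(x)^{1-r}\le\mathrm{gap}(x)$ for all $x\in\mathcal{C}$.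
   Formalization: For r = 0, where 1/r is undefined, m^{1/r}/2^{1/r} and its inverse are read as limits as r decreases to 0 (0, 1 or +∞); existence of S is claimed for r > 0, and for r = 0, m < 2 no S exists, so nothing is claimed there. *)

(* Defs.v *)
From HB Require Import structures.
From mathcomp Require Import all_boot all_order all_algebra.
From mathcomp Require Import all_classical all_reals all_analysis.
Set Implicit Arguments.
Unset Strict Implicit.
Unset Printing Implicit Defensive.
Import Order.TTheory GRing.Theory Num.Theory.
Import numFieldNormedType.Exports.
Local Open Scope classical_set_scope.
Local Open Scope ring_scope.

Section FrankWolfe.
Variables (R : realType) (n : nat).
Implicit Types (C : set 'rV[R]_n) (f : 'rV[R]_n -> R) (x y u v : 'rV[R]_n).

Definition dot u v : R := \sum_(i < n) u 0 i * v 0 i.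

Definition grad f x : 'rV[R]_n := \row_(i < n) 'D_(delta_mx 0 i) f x.

Definition argmin (T : Type) (A : set T) (g : T -> R) : set T :=
  [set a | A a /\ forall b, A b -> g a <= g b].

(* lmo: linear minimization oracle *)
Definition lmo C f x : set 'rV[R]_n :=
  argmin C (fun v => dot (grad f x) (v - x)).

Definition bregman f y x : R := f y - f x - dot (grad f x) (y - x).

(* For C compact and nonempty and f continuous on C, the infimum and the
   supremum below are attained, hence are the minimum and the maximum. *)
Definition subopt C f x : R := f x - inf [set f y | y in C].

Definition gap C f x : R := sup [set dot (grad f x) (x - v) | v in C].

Definition strong_growth0 C f (M : R) : Prop :=
  forall x v, C x -> lmo C f x v ->
  forall eta : R, 0 <= eta <= 1 ->
    bregman f (x + eta *: (v - x)) x <= M * eta ^+ 2 / 2.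

Definition gaps_growth C f (m r : R) : Prop :=
  forall x, C x -> m * subopt C f x `^ (1 - r) <= gap C f x.

Definition frank_wolfe C f (eta : nat -> R) (x v : nat -> 'rV[R]_n) : Prop :=
  C (x 0%N) /\
  forall t : nat, lmo C f (x t) (v t) /\
    x t.+1 = x t + eta t *: (v t - x t).

End FrankWolfe.

Definition step (R : realType) (l t : nat) : R := l%:R / (t + l)%:R.

(* a^(1/r) / b^(1/r), where r = 0 stands for the limit as r decreases to 0
   (for a, b > 0); with the convention 0^-1 = 0 the first formula would give 1
   there. *)
Definition root_ratio (R : realType) (a b r : R) : \bar R :=
  if r == 0 then
    if a < b then 0%E else if a == b then 1%E else +oo%E
  else (a `^ r^-1 / b `^ r^-1)%:E.

Definition is_minimum (A : set nat) (S : nat) : Prop :=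
  A S /\ forall i, A i -> (S <= i)%N.

Definition burn_in (R : realType) (l : nat) (M m r : R) : set nat :=
  [set i : nat | (1 <= i)%N /\ ((step R l i * M)%:E <= root_ratio m 2 r)%E].

(* max {1, ceil (2^(1/r) l M / m^(1/r) - l)} *)
Definition burn_in_bound (R : realType) (l : nat) (M m r : R) : \bar R :=
  maxe 1%E
    (er_map (@Rceil R) (root_ratio 2 m r * (l%:R * M)%:E - l%:R%:E)%E).

Definition rate_bound (R : realType) (n : nat) (C : set 'rV[R]_n)
    (f : 'rV[R]_n -> R) (x : nat -> 'rV[R]_n) (l : nat) (M m r : R)
    (S t : nat) : R :=
  Num.max
    (subopt C f (x S) * (step R l t.-1 / step R l S.-1) ^+ l)
    (step R l t.-1 `^ Num.min (Num.min l%:R (1 - r)^-1) 2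
      * ((M / m) `^ (1 - r)^-1 + M / 2)).

(* Main.v *)
Require Import Defs.
From mathcomp Require Import all_boot all_order all_algebra.
From mathcomp Require Import all_classical all_reals all_analysis.
From mathcomp Require Import ring lra.
Import Order.TTheory GRing.Theory Num.Theory.
Import numFieldNormedType.Exports.
Local Open Scope classical_set_scope.
Local Open Scope ring_scope.
Set Implicit Arguments.
Unset Strict Implicit.
Unset Printing Implicit Defensive.

(** With [h_t = subopt_t] and [G_t = <grad f x_t, x_t - v_t>], strong growth
    gives [h_(t+1) <= h_t - eta_t G_t + M eta_t^2 / 2], while convexity and the
    gaps property give [G_t >= h_t] and [G_t >= m h_t^(1-r)].
    - If [G_t >= h_t + eta_t M / 2], then [h_(t+1) <= (1 - eta_t) h_t], and
      Bernoulli's inequality bounds [1 - eta_t] by [(eta_t / eta_(t-1))^l].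
    - Otherwise, if [2 h_t <= m h_t^(1-r)], then [m h_t^(1-r) < eta_t M], so
      [h_t] is at most [(eta_t M / m)^(1/(1-r))] and [h_(t+1)] is below the
      second term of the bound.
    - Otherwise [h_t > A = (m / 2)^(1/r) >= eta_t M] (for r = 0 this case does
      not occur). For l >= 2 this contradicts the bound [h_t <= eta_t M], valid
      for all t >= 1. For l = 1 only [t h_t <= (M / 2) (1 + ln t)] holds, but
      then [h_t > A] and [h_t + eta_t M / 2 > m h_t^(1-r)] together force t to
      be so large that [(M / 2) (1 + ln (t + 1))] is at most
      [(M / m)^(1/(1-r)) + M / 2]. *)

(** * Logarithmic inequalities *)

(** Concavity: the logarithm lies below its tangent at b. The free point b tunes the numerical
    bounds below. *)
Lemma ln_le_tangent (R : realType) (b x : R) :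
  0 < b -> 0 < x -> ln x <= x / b - 1 + ln b.
Proof.
move=> b0 x0; rewrite -lerBlDr -ln_div ?posrE//.
have xb0 : 0 < x / b by rewrite divr_gt0.
by rewrite -[X in ln X](subrKC 1) le_ln1Dx// ltrBrDr addNr.
Qed.

(** [e = exp(1/8)^8 >= (9/8)^8 > 5/2]. *)
Lemma ln_5_2_le1 (R : realType) : ln (5 / 2) <= 1 :> R.
Proof.
rewrite -[leRHS]expRK ler_ln ?posrE ?expR_gt0 ?divr_gt0//.
have -> : 1 = 8%:R * 8^-1 :> R by lra.
rewrite expRM_natl; apply: (@le_trans _ _ ((9 / 8) ^+ 8)); first lra.
by apply: lerXn2r; rewrite ?nnegrE ?expR_ge0//; have := expR_ge1Dx (8^-1 : R); lra.
Qed.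

(** [exp(-1/2) = exp(-1/10)^5 >= (9/10)^5 > 10/17]. *)
Lemma ln_17_10_ge (R : realType) : 1 / 2 <= ln (17 / 10) :> R.
Proof.
rewrite -[leLHS]expRK ler_ln ?posrE ?expR_gt0 ?divr_gt0//.
have -> : 1 / 2 = - (5%:R * - 10^-1) :> R by lra.
rewrite expRN expRM_natl -[leRHS]invrK lef_pV2 ?posrE ?exprn_gt0 ?expR_gt0//.
  apply: (@le_trans _ _ ((9 / 10) ^+ 5)); first lra.
  by apply: lerXn2r; rewrite ?nnegrE ?expR_ge0//; have := expR_ge1Dx (- 10^-1 : R); lra.
Qed.

Lemma ln_le_linear (R : realType) (x : R) : 0 < x -> ln x <= 2 / 5 * x.
Proof.
move=> x0; apply: le_trans (@ln_le_tangent _ (5 / 2) _ _ x0) _; first lra.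
have -> : x / (5 / 2) = 2 / 5 * x by field; lra.
by have := ln_5_2_le1 R; lra.
Qed.

Lemma ln_le_sqrt (R : realType) (x : R) : 0 < x -> ln x <= 4 / 5 * Num.sqrt x.
Proof.
move=> x0; have s0 : 0 < Num.sqrt x by rewrite sqrtr_gt0.
rewrite -[x in leLHS](sqr_sqrtr (ltW x0)) lnXn// -[ln _ *+ 2]mulr_natr.
by have := ln_le_linear s0; lra.
Qed.

Lemma ln_succ_le (R : realType) (t : R) : 0 < t -> ln (t + 1) <= ln t + t^-1.
Proof.
move=> t0; have := @ln_le_tangent _ t (t + 1) t0.
have -> : (t + 1) / t - 1 = t^-1 by field; lra.
by move=> H; have := H ltac:(lra); lra.
Qed.

(* Settles [ln_succ_le_powR] for r >= 1/2, where the exponent is at least 1. *)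
Lemma ln_succ_le_weight (R : realType) (t a h : R) : 1 <= t ->
  2 * a <= t + 1 -> t * h <= a * (1 + ln t) -> 3 / 2 <= h -> ln (t + 1) <= a.
Proof.
move=> t1 at1 tha h32.
have t0 : 0 < t by lra.
have lnt0 := ln_ge0 t1.
(* The hypotheses give [3 t <= (t + 1) (1 + 2 t / 5)], a quadratic inequality that fails on
   [1, 16/5]. *)
have t3 : 16 / 5 < t.
  rewrite ltNge; apply/negP => t3.
  have lnt := ln_le_linear t0.
  have : 3 * t <= (t + 1) * (1 + 2 / 5 * t) by nra.
  by nra.
have t10 : 0 < t + 1 by lra.
have := ln_le_sqrt t0; have := ln_le_sqrt t10.
have := sqr_sqrtr (ltW t0); have := sqr_sqrtr (ltW t10).
have := sqrtr_ge0 t; have := sqrtr_ge0 (t + 1).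
set s := Num.sqrt t; set s' := Num.sqrt (t + 1) => s'0 s0 s'E sE T lnt.
have s1 : 17 / 10 < s by nra.
have ss' : s' <= s + 3 / 10 by nra.
(* If [a < ln (t + 1) <= 4 s' / 5], then [3 s^2 / 2 <= t h <= (4 s' / 5) (1 + 4 s / 5)]; as
   [s' <= s + 3/10], this fails for [s > 17/10]. *)
rewrite leNgt; apply/negP => aT.
have : 3 / 2 * t <= (4 / 5 * s') * (1 + 4 / 5 * s).
  apply: le_trans (_ : t * h <= _); first nra.
  have a0 : 0 <= a by nra.
  by apply: le_trans tha _; apply: ler_pM; lra.
by nra.
Qed.

(** Put [T = ln (t + 1)]. The bound on [t h] makes h at most linear in T, while ln a is at least T
    up to a term of order ln T. The product of logarithms on the left is at most a small multiple of
    T, so it suffices that T is moderately large. *)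
Lemma ln_ln_succ_le (R : realType) (t a h : R) : 1 <= t ->
  2 * a <= t + 1 -> t * h <= a * (1 + ln t) -> 29 / 10 < h ->
  ln (ln (t + 1)) * ln ((h + 1 / 2) / 2) <= 1 / 2 * ln a.
Proof.
move=> t1 at1 tha h29.
have t0 : 0 < t by lra.
have h0 : 0 < h by lra.
have lnt0 : 0 <= 1 + ln t by have := ln_ge0 t1; lra.
have ht1 : t * h <= (t + 1) / 2 * (1 + ln t).
  by have := ler_wpM2r lnt0 at1; lra.
have key : 29 / 5 * t < (t + 1) * (1 + ln t).
  by rewrite -(ltr_pM2l t0) in h29; lra.
(* With [s = sqrt t] and [ln t <= 4 s / 5], [key] becomes a cubic inequality that fails for s in
   [1, 28/5]. *)
have t31 : 31 < t.
  have := ln_le_sqrt t0; have := sqr_sqrtr (ltW t0).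
  have : 1 <= Num.sqrt t by rewrite -sqrtr1 ler_wsqrtr//; lra.
  move: (Num.sqrt t) => s s1 st lts.
  have {}key : 29 / 5 * s ^+ 2 < (s ^+ 2 + 1) * (1 + 4 / 5 * s) by nra.
  have : 28 / 5 < s.
    rewrite ltNge; apply/negP => s28.
    have : 0 <= (s - 1) * (28 / 5 - s) by rewrite mulr_ge0; lra.
    by clear -key s1; nra.
  by nra.
have lntT : ln t <= ln (t + 1) by rewrite ler_ln ?posrE; lra.
have lnTt : ln (t + 1) <= ln t + 1 / 31.
  apply: le_trans (ln_succ_le t0) _.
  by rewrite lerD2l div1r lef_pV2 ?posrE; lra.
have tT : (t + 1) * ln t <= (t + 1) * ln (t + 1) by rewrite ler_pM2l//; lra.
(* By [key] again: [T <= 23/5] would give [29 t / 5 < 28 (t + 1) / 5], hence [t < 28]. *)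
have T46 : 23 / 5 < ln (t + 1).
  rewrite ltNge; apply/negP => T46.
  have : (t + 1) * ln (t + 1) <= (t + 1) * (23 / 5) by rewrite ler_pM2l//; lra.
  by lra.
have hT : t * h <= (t + 1) / 2 * (1 + ln (t + 1)) by lra.
have lnta : ln t + ln h - ln (1 + ln (t + 1)) <= ln a.
  have T0 : 0 < 1 + ln (t + 1) by lra.
  have ht0 := mulr_gt0 t0 h0.
  have a0 : 0 < a by clear -tha lnt0 ht0; nra.
  rewrite -lnM// -ln_div ?posrE// ler_ln ?posrE ?divr_gt0// ler_pdivrMr//.
  by apply: le_trans tha _; rewrite ler_pM2l// lerD2l.
have lnh : 1 <= ln h.
  have : ln ((17 / 10) ^+ 2) <= ln h by rewrite ler_ln ?posrE; lra.
  by rewrite lnXn -?[ln _ *+ 2]mulr_natr; have := ln_17_10_ge R; lra.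
move: (ln (t + 1)) T46 hT lnta lntT lnTt => T T46 hT lnta lntT lnTt.
clear tha.
have ht : h <= 16 / 31 * (1 + T) by nra.
have T0 : 0 < T by lra.
have T10 : 0 < 1 + T by lra.
have ln1T : ln (1 + T) <= 2 / 11 * (1 + T) + 22 / 25.
  have := ln_le_sqrt T10; have := sqr_sqrtr (ltW T10).
  by move: (Num.sqrt _) => u uE; have := sqr_ge0 (u - 11 / 5); nra.
pose y := (h + 1 / 2) / 2.
have y0 : 0 < y by rewrite /y; lra.
(* AM-GM: [ln T ln y <= (16/25) sqrt (T y) <= (16/25) (T/4 + y)]. By [ht] and [ln1T] the comparison
   with [ln a / 2] is then linear in T, and holds for [T > 23/5]. *)
apply: (@le_trans _ _ (16 / 25 * (T / 4 + y))); last by rewrite /y; lra.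
have := ln_le_sqrt T0; have := ln_le_sqrt y0.
have := sqr_sqrtr (ltW T0); have := sqr_sqrtr (ltW y0).
have : 0 <= ln T by apply: ln_ge0; lra.
have : 0 <= ln y by apply: ln_ge0; rewrite /y; lra.
rewrite -/y; move: (Num.sqrt T) (Num.sqrt y) (ln T) (ln y) => u w p q.
move=> q0 p0 wE uE qw pu; rewrite -uE -wE.
have := ler_pM p0 q0 pu qw.
by have := sqr_ge0 (u / 2 - w); nra.
Qed.

(* This is where the harmonic factor [1 + ln t] in the crude bound for l = 1
   is absorbed: a failure of [h + 1/2 <= 2 h^(1-r)] forces h, hence ln t, to be
   exponentially large in 1/r, while a is of the order of t. *)
Lemma ln_succ_le_powR (R : realType) (t a h r : R) : 1 <= t ->
  0 <= r -> r < 1 -> 1 < h ->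
  2 * a <= t + 1 -> t * h <= a * (1 + ln t) -> 2 * h `^ (1 - r) < h + 1 / 2 ->
  ln (t + 1) <= a `^ (r / (1 - r)).
Proof.
move=> t1 r0 r1 h1 at1 tha hr.
have hr1 : 1 <= h `^ (1 - r).
  by rewrite -[X in X <= _](powRr0 h) ler_powR; lra.
have h32 : 3 / 2 <= h by lra.
have Ta := ln_succ_le_weight t1 at1 tha h32.
(* The case [a <= 1] is void: [t h <= 1 + ln t <= t], but [h >= 3/2]. *)
have [a1|a1] := leP a 1.
  have t0 : 0 < t by lra.
  have : ln t <= t - 1 by have := ln_le_tangent ltr01 t0; rewrite divr1 ln1 addr0.
  by have := ln_ge0 t1; nra.
have [T1|T1] := leP (ln (t + 1)) 1.
  apply: le_trans T1 _; rewrite -[leLHS](powRr0 a).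
  apply: ler_powR; first exact: ltW.
  by rewrite divr_ge0// subr_ge0 ltW.
have [r12|r12] := leP (1 / 2) r.
  apply: le_trans Ta _; apply: le1r_powR; first lra.
  by rewrite ler_pdivlMr; lra.
(* Since [r < 1/2], [w = sqrt h >= 1] satisfies [2 w < w^2 + 1/2], so [w > 1 + 1 / sqrt 2]. *)
have h29 : 29 / 10 < h.
  have : Num.sqrt h <= h `^ (1 - r).
    by rewrite -powR12_sqrt ?ler_powR//; lra.
  have := @sqr_sqrtr _ h ltac:(lra).
  have : 1 <= Num.sqrt h by rewrite -sqrtr1 ler_wsqrtr//; lra.
  by move: (Num.sqrt h) => w; clear -hr; nra.
have := ln_ln_succ_le t1 at1 tha h29.
clear Ta at1 tha; move: (ln (t + 1)) T1 => T T1.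
set y := (h + 1 / 2) / 2 => lnTlny.
have lnhr : (1 - r) * ln h < ln y.
  by rewrite -ln_powR ltr_ln ?posrE ?powR_gt0// /y; lra.
have lnhy : ln y + 1 / 2 <= ln h.
  apply: le_trans (_ : ln y + ln (17 / 10) <= _).
    by rewrite lerD2l ln_17_10_ge.
  by rewrite -lnM ?posrE ?ler_ln ?posrE /y; lra.
have lny0 : 0 < ln y by rewrite ln_gt0 /y; lra.
have lna0 : 0 < ln a by rewrite ln_gt0.
(* The goal is [(1 - r) ln T <= r ln a]. Multiplied by [ln y > 0], it follows from
   [ln T ln y <= ln a / 2] and [(1 - r) / 2 <= r ln y]. *)
rewrite -ler_ln ?posrE ?powR_gt0//; [|lra|lra].
rewrite ln_powR mulrAC ler_pdivlMr ?subr_gt0// -(ler_pM2r lny0).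
have r10 : 0 <= 1 - r by lra.
have rlny : (1 - r) * (1 / 2) <= r * ln y.
  by have := ler_wpM2l r10 lnhy; lra.
have := ler_wpM2l (ltW lna0) rlny; have := ler_wpM2l r10 lnTlny.
by lra.
Qed.

(** * The scalar recursion *)

Lemma bernoulli_ineq (R : realDomainType) (x : R) (n : nat) :
  0 <= 1 + x -> 1 + n%:R * x <= (1 + x) ^+ n.
Proof.
move=> x1; elim: n => [|n IH]; first by rewrite mul0r addr0 expr0.
rewrite exprS -natr1; apply: le_trans (ler_wpM2l x1 IH).
by have := sqr_ge0 x; have : 0 <= n%:R :> R by []; nra.
Qed.

Lemma step_gt0 (R : realType) (l t : nat) : (0 < l)%N -> 0 < step R l t.
Proof. by move=> l0; rewrite divr_gt0 ?ltr0n// addn_gt0 l0 orbT. Qed.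

Lemma step_le1 (R : realType) (l t : nat) : (0 < l)%N -> step R l t <= 1.
Proof.
by move=> l0; rewrite ler_pdivrMr ?mul1r ?ler_nat ?leq_addl// ltr0n addn_gt0 l0 orbT.
Qed.

Lemma step_antitone (R : realType) (l s t : nat) : (0 < l)%N -> (s <= t)%N ->
  step R l t <= step R l s.
Proof.
move=> l0 st; rewrite ler_pM2l ?ltr0n// lef_pV2 ?posrE ?ltr0n ?addn_gt0 ?l0 ?orbT//.
by rewrite ler_nat leq_add2r.
Qed.

(** The ratio of consecutive steps is [1 - 1 / (t + 1 + l)], so this is Bernoulli's inequality for
    its l-th power. *)
Lemma step_contraction (R : realType) (l t : nat) : (0 < l)%N ->
  1 - step R l t.+1 <= (step R l t.+1 / step R l t) ^+ l.
Proof.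
move=> l0; have l0' : (0 < l%:R :> R) by rewrite ltr0n.
have t0 : 0 <= t%:R :> R by [].
have -> : step R l t.+1 / step R l t = 1 + - (t.+1 + l)%:R^-1.
  rewrite /step !natrD -natr1; field; lra.
have -> : 1 - step R l t.+1 = 1 + l%:R * - (t.+1 + l)%:R^-1.
  by rewrite /step mulrN.
apply: bernoulli_ineq; rewrite subr_ge0 invf_le1 ?ltr0n//.
by rewrite ler1n addSn.
Qed.

(** The factor [(e' / e)^l] carries the first term at e exactly to the first term at e'. It is at
    most [(e' / e)^q], as [e' <= e] and [q <= l], so it also carries the second. *)
Lemma max_rate_contraction (R : realType) (l : nat) (q c K eS e e' h h' : R) :
  0 < eS -> 0 < e' -> e' <= e -> q <= l%:R -> 0 <= h -> 0 <= K -> 0 <= c ->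
  h' <= (e' / e) ^+ l * h ->
  h <= Num.max (K * (e / eS) ^+ l) (e `^ q * c) ->
  h' <= Num.max (K * (e' / eS) ^+ l) (e' `^ q * c).
Proof.
move=> eS0 e'0 e'e ql h0 K0 c0 h'h.
have e0 : 0 < e by exact: lt_le_trans e'e.
have r0 : 0 <= e' / e by rewrite divr_ge0 ?ltW.
rewrite !le_max => /orP[hK|hc]; apply/orP; [left|right].
- apply: le_trans h'h _; apply: le_trans (ler_wpM2l (exprn_ge0 _ r0) hK) _.
  rewrite mulrCA -exprMn; have -> // : e' / e * (e / eS) = e' / eS.
  by field; lra.
- apply: le_trans h'h _; apply: le_trans (ler_wpM2l (exprn_ge0 _ r0) hc) _.
  rewrite mulrA ler_wpM2r// -powR_mulrn//.
  apply: le_trans (_ : (e' / e) `^ q * e `^ q <= _).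
    rewrite ler_wpM2r ?powR_ge0//; apply: ger_powR => //.
    by rewrite divr_gt0//= ler_pdivrMr// mul1r.
  by rewrite -powRM ?(ltW e0)// divfK// gt_eqF.
Qed.

(** Replacing h by [m h^(1-r) / 2] in the upper bound on G gives [m h^(1-r) < eta M]. Since
    [eta <= 1], the exponents 1/(1-r) and 2 may both be lowered to q. *)
Lemma small_gap_rate (R : realType) (M m r q eta h h' G : R) :
  0 < M -> 0 < m -> r < 1 -> 0 < eta <= 1 -> q <= (1 - r)^-1 -> q <= 2 -> 0 <= h ->
  2 * h <= m * h `^ (1 - r) -> m * h `^ (1 - r) <= G -> G < h + eta * M / 2 ->
  h' <= h - eta * G + M * eta ^+ 2 / 2 ->
  h' <= eta `^ q * ((M / m) `^ (1 - r)^-1 + M / 2).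
Proof.
move=> M0 m0 r1 /andP[e0 e1] qp q2 h0 hm mG Gh h'h.
have p0 : 0 < (1 - r)^-1 by rewrite invr_gt0 subr_gt0.
have hle : h `^ (1 - r) <= eta * (M / m).
  by rewrite mulrA ler_pdivlMr//; lra.
have {}hle : h <= eta `^ (1 - r)^-1 * (M / m) `^ (1 - r)^-1.
  rewrite -powRM ?divr_ge0//; [|lra|lra|lra].
  have -> : h = (h `^ (1 - r)) `^ (1 - r)^-1.
    by rewrite -powRrM mulfV ?powRr1//; lra.
  apply: ge0_ler_powR hle; rewrite ?nnegrE ?powR_ge0 ?(ltW p0)//.
  by rewrite mulr_ge0 ?divr_ge0 ?ltW.
have G0 : 0 <= eta * G by apply: mulr_ge0; lra.
apply: (@le_trans _ _ (eta `^ (1 - r)^-1 * (M / m) `^ (1 - r)^-1 + eta `^ 2 * (M / 2))).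
  by rewrite powR_mulrn ?(ltW e0)//; lra.
by rewrite mulrDr lerD// ler_wpM2r ?powR_ge0 ?divr_ge0 ?(ltW M0)// ger_powR ?e0.
Qed.

(** Dividing by the threshold A, with [a = M / (2 A)], turns the hypotheses into those of
    [ln_succ_le_powR] for [h / A]. The first term on the right equals [(M / 2) a^(r/(1-r))], which
    reduces the claim to [ln (t + 1) <= a^(r/(1-r))]. *)
Lemma log_le_weight (R : realType) (M r A h t : R) :
  0 < M -> 0 < A -> 0 < r -> r < 1 -> 1 <= t ->
  M / (t + 1) <= A -> A < h -> t * h <= M / 2 * (1 + ln t) ->
  2 * A `^ r * h `^ (1 - r) < h + M / (t + 1) / 2 ->
  M / 2 * (1 + ln (t + 1)) <= (M / (2 * A `^ r)) `^ (1 - r)^-1 + M / 2.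
Proof.
move=> M0 A0 r0 r1 t1 MA Ah th hr.
pose a := M / (2 * A).
have a0 : 0 < a by rewrite divr_gt0// mulr_gt0.
have aA : a * A = M / 2 by rewrite /a; field; lra.
have Ar : A `^ r * A `^ (1 - r) = A.
  by rewrite -powRD ?subrKC ?powRr1 ?ltW// gt_eqF.
have Ar0 : 0 < A `^ r by rewrite powR_gt0.
have r10 : 1 - r != 0 by lra.
have h0 : 0 < h by lra.
have hA1 : 1 < h / A by rewrite ltr_pdivlMr ?mul1r.
have at1 : 2 * a <= t + 1.
  rewrite -(ler_pM2r A0) -mulrA aA.
  by move: MA; rewrite ler_pdivrMr; lra.
have tha : t * (h / A) <= a * (1 + ln t).
  by rewrite mulrA ler_pdivrMr// mulrAC aA.
have hA : 2 * (h / A) `^ (1 - r) < h / A + 1 / 2.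
  have hA0 : 0 <= h / A by rewrite divr_ge0 ?ltW.
  have hE : A `^ (1 - r) * (h / A) `^ (1 - r) = h `^ (1 - r).
    by rewrite -powRM ?(ltW A0)//; congr (_ `^ _); field; lra.
  have lhsE : A * (2 * (h / A) `^ (1 - r)) = 2 * A `^ r * h `^ (1 - r).
    by rewrite -hE -mulrA [A `^ r * _]mulrA Ar mulrCA.
  rewrite -(ltr_pM2l A0) lhsE; apply: lt_le_trans hr _.
  have -> : A * (h / A + 1 / 2) = h + A / 2 by field; lra.
  by rewrite lerD2l; lra.
have ln_le := ln_succ_le_powR t1 (ltW r0) r1 hA1 at1 tha hA.
have -> : M / (2 * A `^ r) = a * A `^ (1 - r).
  have aE : a * A `^ (1 - r) * A `^ r = M / 2.
    by rewrite -mulrA [X in _ * X]mulrC Ar.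
  by apply: (mulIf (lt0r_neq0 Ar0)); rewrite aE; field; lra.
rewrite powRM ?powR_ge0 ?(ltW a0)// -(powRrM A) mulfV// powRr1 ?(ltW A0)//.
have -> : (1 - r)^-1 = 1 + r / (1 - r) by field.
rewrite powRD ?powRr1 ?(ltW a0)//; last by rewrite (lt0r_neq0 a0) implybT.
rewrite [a * _ * A]mulrAC aA mulrDr mulr1 addrC lerD2r ler_pM2l//; lra.
Qed.

Lemma descent_le (R : realType) (e M h h' G : R) :
  0 <= e -> h <= G -> h' <= h - e * G + M * e ^+ 2 / 2 ->
  h' <= (1 - e) * h + M * e ^+ 2 / 2.
Proof.
move=> e0 hG h'h; apply: le_trans h'h _.
by rewrite lerD2r mulrBl mul1r lerD2l lerN2 ler_wpM2l.
Qed.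

Lemma step0 (R : realType) (l : nat) : (0 < l)%N -> step R l 0 = 1.
Proof. by move=> l0; rewrite /step add0n mulfV// pnatr_eq0 -lt0n. Qed.

(** Induction from [h 1 <= M / 2], since the initial step is 1. The inductive step needs
    [eta - eta^2 / 2] to be at most the next step; with [N = t + 1 + l] this amounts to
    [l (N + 1) >= 2 N], whence [l >= 2]. *)
Lemma le_step_of_descent (R : realType) (l : nat) (M : R) (h : nat -> R) :
  (2 <= l)%N -> 0 < M ->
  (forall t, h t.+1 <= (1 - step R l t) * h t + M * step R l t ^+ 2 / 2) ->
  forall t, h t.+1 <= step R l t.+1 * M.
Proof.
move=> l2 M0 hrec; have l0 : (0 < l)%N by exact: ltnW.
have l2' : 2 <= l%:R :> R by rewrite ler_nat.
elim=> [|t IH].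
  apply: le_trans (hrec 0%N) _; rewrite step0// subrr mul0r add0r expr1n mulr1.
  rewrite [leRHS]mulrC ler_wpM2l ?(ltW M0)// /step natrD.
  by rewrite ler_pdivlMr; lra.
apply: le_trans (hrec t.+1) _.
have e1 := step_le1 R t.+1 l0.
have : (1 - step R l t.+1) * h t.+1 <= (1 - step R l t.+1) * (step R l t.+1 * M).
  by rewrite ler_wpM2l// subr_ge0.
suff : step R l t.+1 - step R l t.+1 ^+ 2 / 2 <= step R l t.+2.
  by rewrite -(ler_pM2r M0); lra.
pose N : R := (t.+1 + l)%:R.
have -> : step R l t.+2 = l%:R / (N + 1) by rewrite /step addSn -natr1.
rewrite /step -/N.
have N0 : 0 < N by rewrite ltr0n.
rewrite -subr_ge0.
have -> : l%:R / (N + 1) - (l%:R / N - (l%:R / N) ^+ 2 / 2) =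
   l%:R * (l%:R * (N + 1) - 2 * N) / (2 * N ^+ 2 * (N + 1)) :> R.
  by field; lra.
rewrite divr_ge0// ?mulr_ge0 ?exprn_ge0//; nra.
Qed.

(** For l = 1 the recursion multiplied by N telescopes: [N h_N <= (N - 1) h_(N-1) + M / (2 N)], and
    [1 / N <= ln N - ln (N - 1)]. *)
Lemma le_log_of_descent (R : realType) (M : R) (h : nat -> R) :
  0 < M ->
  (forall t, h t.+1 <= (1 - step R 1 t) * h t + M * step R 1 t ^+ 2 / 2) ->
  forall t, t.+1%:R * h t.+1 <= M / 2 * (1 + ln t.+1%:R).
Proof.
move=> M0 hrec; elim=> [|t IH].
  by have := hrec 0%N; rewrite step0// subrr mul0r ln1; lra.
have := hrec t.+1; rewrite /step addn1; set N : R := t.+2%:R.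
have NE : t.+1%:R = N - 1 by rewrite /N -(natr1 t.+1) addrK.
have N1 : 1 < N by rewrite /N ltr1n.
clearbody N.
rewrite NE in IH; rewrite div1r => hN.
have lnN : ln (N - 1) + N^-1 <= ln N.
  have := @ln_le_tangent _ N (N - 1) ltac:(lra) ltac:(lra).
  have -> : (N - 1) / N - 1 = - N^-1 by field; lra.
  by lra.
apply: (@le_trans _ _ ((N - 1) * h t.+1 + M / 2 * N^-1)).
  have -> : (N - 1) * h t.+1 + M / 2 * N^-1 =
     N * ((1 - N^-1) * h t.+1 + M * N^-1 ^+ 2 / 2) by field; lra.
  by rewrite ler_pM2l//; lra.
apply: le_trans (lerD IH (lexx _)) _.
by rewrite -mulrDr ler_pM2l; lra.
Qed.

(** The rate for abstract sequences: h is to be the suboptimality and G the value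
    [<grad f x_t, x_t - v_t>]. *)
Lemma seq_rate (R : realType) (l S : nat) (M m r : R) (h G : nat -> R) :
  (0 < l)%N -> 0 < M -> 0 < m -> 0 <= r -> r < 1 ->
  (forall t, 0 <= h t) -> (forall t, h t <= G t) ->
  (forall t, m * h t `^ (1 - r) <= G t) ->
  (forall t, h t.+1 <= h t - step R l t * G t + M * step R l t ^+ 2 / 2) ->
  burn_in l M m r S -> forall t, (S <= t)%N ->
  h t <= Num.max (h S * (step R l t.-1 / step R l S.-1) ^+ l)
    (step R l t.-1 `^ Num.min (Num.min l%:R (1 - r)^-1) 2
      * ((M / m) `^ (1 - r)^-1 + M / 2)).
Proof.
move=> l0 M0 m0 r0 r1 h0 hG hm hrec [S1 SM]; set q := Num.min _ 2; set c := _ + M / 2.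
have hrec' t : h t.+1 <= (1 - step R l t) * h t + M * step R l t ^+ 2 / 2.
  exact: descent_le (ltW (step_gt0 R t l0)) (hG t) (hrec t).
have c0 : 0 <= c by rewrite addr_ge0 ?powR_ge0 ?divr_ge0 ?ltW.
have ql : q <= l%:R by rewrite /q !ge_min lexx.
have qp : q <= (1 - r)^-1 by rewrite /q !ge_min lexx orbT.
have q2 : q <= 2 by rewrite /q ge_min lexx orbT.
(* The bound at t involves [t.-1], so t = 1 (where S = 1) is settled apart and the induction passes
   from [t.+1] to [t.+2]. *)
elim=> [|[_|t IH]]; first by case: S S1 {SM}.
  move=> St; have -> : S = 1%N by apply/eqP; rewrite eqn_leq St S1.
  by rewrite divff ?gt_eqF ?step_gt0// expr1n mulr1 le_max lexx.
rewrite leq_eqVlt => /predU1P[->|].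
  by rewrite divff ?gt_eqF ?step_gt0// expr1n mulr1 le_max lexx.
rewrite ltnS => St; have {}IH := IH St; move: IH; rewrite !succnK => IH.
have e0 := step_gt0 R t.+1 l0; have e1 := step_le1 R t.+1 l0.
have [GE|GL] := leP (h t.+1 + step R l t.+1 * M / 2) (G t.+1).
  apply: (max_rate_contraction (step_gt0 R S.-1 l0) e0 (step_antitone R l0 (leqnSn t))
    ql (h0 t.+1) (h0 S) c0 _ IH).
  apply: le_trans (ler_wpM2r (h0 _) (step_contraction R t l0)).
  by apply: le_trans (hrec t.+1) _; nra.
rewrite le_max; apply/orP; right.
have [hm2|hm2] := leP (2 * h t.+1) (m * h t.+1 `^ (1 - r)).
  apply: (small_gap_rate M0 m0 r1 _ qp q2 (h0 t.+1) hm2 (hm _) GL (hrec _)).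
  by rewrite e0 e1.
(* For r = 0: if [m < 2], the threshold is 0 and no positive step meets it; if [m >= 2], [m h < 2 h]
   is absurd. *)
move: SM; rewrite /root_ratio; case: eqP => [rE|/eqP r_neq0].
  case: (ltP m 2) => m2 /=.
    rewrite lee_fin => SM.
    by have := mulr_gt0 (step_gt0 R S l0) M0; rewrite ltNge SM.
  by move: hm2; rewrite rE subr0 powRr1// ltNge ler_wpM2r.
rewrite lee_fin; set A := _ / _ => SA.
have {}r0 : 0 < r by rewrite lt_neqAle eq_sym r_neq0.
have A0 : 0 < A by rewrite divr_gt0 ?powR_gt0.
have mE : m = 2 * A `^ r.
  have : (A * 2 `^ r^-1) `^ r = m.
    by rewrite /A divfK ?gt_eqF ?powR_gt0// -powRrM mulVf// powRr1 ?ltW.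
  rewrite powRM ?powR_ge0 ?(ltW A0)// -(powRrM 2) mulVf// powRr1// => <-.
  by rewrite mulrC.
have eA : step R l t.+1 * M <= A.
  by apply: le_trans SA; rewrite ler_wpM2r ?step_antitone ?ltW.
(* As [m = 2 A^r], [hm2] reads [A^r h^(1-r) < h = h^r h^(1-r)]. *)
have Ah : A < h t.+1.
  rewrite ltNge; apply/negP => hA; move: hm2; apply/negP; rewrite -leNgt.
  rewrite mE -mulrA ler_pM2l//.
  have {1}-> : h t.+1 = h t.+1 `^ r * h t.+1 `^ (1 - r).
    by rewrite -powRD ?subrKC ?powRr1 ?oner_eq0.
  rewrite ler_wpM2r ?powR_ge0//.
  by apply: ge0_ler_powR; rewrite ?nnegrE ?(ltW A0) ?(ltW r0).
have [l2|] := leqP 2 l.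
  have hA := le_trans (le_step_of_descent l2 M0 hrec' t) eA.
  by have := le_lt_trans hA Ah; rewrite ltxx.
move=> l1; have {l1} lE : l = 1%N by apply/eqP; rewrite eqn_leq l0 -ltnS l1.
have hlog := le_log_of_descent M0.
rewrite {}lE in q ql qp q2 e0 e1 IH hrec' GL eA *.
have q1 : q = 1.
  rewrite /q (@min_l _ _ 1%:R) ?min_l ?ler1n//.
  by rewrite -invr1 lef_pV2 ?posrE; lra.
rewrite q1 powRr1 ?(ltW e0)//.
(* The logarithmic bound is used twice: at time [t.+1] as a hypothesis of [log_le_weight], and at
   time [t.+2], where that lemma bounds its right-hand side. *)
have := hlog _ hrec' t.+1; have := hlog _ hrec' t.
have sE : step R 1 t.+1 = (t.+1%:R + 1)^-1 by rewrite /step div1r natrD.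
have hle := @log_le_weight R M r A (h t.+1) t.+1%:R M0 A0 r0 r1.
rewrite sE in GL eA *; rewrite [_ * M]mulrC in eA.
rewrite -mE ler1n in hle => /(hle isT eA Ah) {}hle.
have := hm t.+1 => hmG.
rewrite -natr1 => th; rewrite mulrC ler_pdivlMr; last by rewrite natr1.
rewrite mulrC; apply: le_trans th _; apply: hle.
by rewrite [M / _]mulrC; lra.
Qed.

(** * The Frank-Wolfe iterates *)

Section Gradient.
Variables (R : realType) (n : nat).
Implicit Types (C : set 'rV[R]_n) (f : 'rV[R]_n -> R) (x y u v : 'rV[R]_n).

Lemma dot_gradE f x u : differentiable f x -> dot (grad f x) u = 'D_u f x.
Proof.
move=> df; rewrite deriveE// {2}(row_sum_delta u) linear_sum /dot.
by apply: eq_bigr => i _; rewrite linearZ/= mxE deriveE// mulrC.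
Qed.

Lemma dotBr u v w : dot u (v - w) = dot u v - dot u w.
Proof. by rewrite /dot -sumrB; apply: eq_bigr => i _; rewrite !mxE mulrBr. Qed.

Lemma dotZr u (a : R) v : dot u (a *: v) = a * dot u v.
Proof. by rewrite /dot mulr_sumr; apply: eq_bigr => i _; rewrite !mxE mulrCA. Qed.

Lemma segmentE x y (t : R) : x + t *: (y - x) = t *: y + (1 - t) *: x.
Proof. by rewrite scalerBr scalerBl scale1r addrCA. Qed.

Lemma convex_set_segment C x y (t : R) : @convex_set R 'rV[R]_n C -> C x -> C y ->
  0 <= t <= 1 -> C (x + t *: (y - x)).
Proof.
move=> cC Cx Cy /andP[t0 t1].
have := cC y x (Itv01 t0 t1); rewrite !inE => /(_ Cy Cx).
by rewrite -[conv _ _ _]/(t *: y + (1 - t) *: x) segmentE.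
Qed.

Lemma convex_function_segment C f x y (t : R) : @convex_function R 'rV[R]_n C f ->
  C x -> C y -> 0 <= t <= 1 -> f (x + t *: (y - x)) <= f x + t * (f y - f x).
Proof.
move=> cf Cx Cy /andP[t0 t1].
have := cf (Itv01 t0 t1) y x; rewrite !inE => /(_ Cy Cx).
rewrite -[conv _ (y : convex_lmodType _) x]/(t *: y + (1 - t) *: x) -segmentE.
by rewrite -[conv _ _ _]/(t * f y + (1 - t) * f x); lra.
Qed.

(** Convexity is available only along the segment from x to y, so the derivative is taken as a right
    limit; for 0 < h <= 1 each difference quotient is at most [f y - f x]. *)
Lemma gradient_inequality C f x y : @convex_function R 'rV[R]_n C f ->
  differentiable f x -> C x -> C y -> dot (grad f x) (y - x) <= f y - f x.
Proof.
move=> cf df Cx Cy; rewrite dot_gradE//.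
have /(@diff_derivable _ _ _ _ _ (y - x)) dfv := df.
rewrite /derive cvg_at_rightE//; apply: limr_le.
  apply/cvg_ex; eexists; apply: cvg_trans dfv; apply: cvg_app.
  move=> A [e egt0 Ae]; exists e => // h he h0; apply: Ae => //.
  exact/lt0r_neq0.
near=> h.
have h0 : 0 < h by near: h; exists 1 => /=.
have h1 : h <= 1 by near: h; exact: nbhs_right_le.
rewrite /shift/= [h *: _ + x]addrC ler_pdivrMl//.
have := convex_function_segment cf Cx Cy (t := h); rewrite h1 ltW// => /(_ isT).
by rewrite lerBlDl.
Unshelve. all: by end_near.
Qed.

End Gradient.

Section Iterates.
Variables (R : realType) (n : nat).
Implicit Types (C : set 'rV[R]_n) (f : 'rV[R]_n -> R) (x y u v : 'rV[R]_n).

Lemma lmo_ge C f x v y : lmo C f x v -> C y ->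
  dot (grad f x) (x - y) <= dot (grad f x) (x - v).
Proof. by move=> [_ vmin] Cy; have := vmin y Cy; rewrite !dotBr; lra. Qed.

Lemma subopt_le_lmo C f x v : @convex_function R 'rV[R]_n C f ->
  differentiable f x -> C x -> lmo C f x v ->
  subopt C f x <= dot (grad f x) (x - v).
Proof.
move=> cf df Cx xv; rewrite /subopt lerBlDl -lerBlDr.
apply: lb_le_inf; first by exists (f x); exists x.
move=> _ [y Cy <-]; have := gradient_inequality cf df Cx Cy.
by have := lmo_ge xv Cy; rewrite !dotBr; lra.
Qed.

(** The oracle point v provides a lower bound of f on C, so that [inf] is a genuine infimum. *)
Lemma subopt_ge0 C f x v : @convex_function R 'rV[R]_n C f ->
  differentiable f x -> C x -> lmo C f x v -> 0 <= subopt C f x.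
Proof.
move=> cf df Cx xv; rewrite subr_ge0; apply: ge_inf; last by exists x.
exists (f x - dot (grad f x) (x - v)) => _ [y Cy <-].
by have := gradient_inequality cf df Cx Cy; have := lmo_ge xv Cy; rewrite !dotBr; lra.
Qed.

Lemma gap_le_lmo C f x v : C x -> lmo C f x v ->
  gap C f x <= dot (grad f x) (x - v).
Proof.
move=> Cx xv; apply: ge_sup; last by move=> _ [y Cy <-]; exact: lmo_ge xv Cy.
by exists (dot (grad f x) (x - x)), x.
Qed.

(** Strong growth bounds f at the new point from above; the infimum cancels. *)
Lemma subopt_descent C f M x v (eta : R) : strong_growth0 C f M -> C x ->
  lmo C f x v -> 0 <= eta <= 1 ->
  subopt C f (x + eta *: (v - x)) <=
    subopt C f x - eta * dot (grad f x) (x - v) + M * eta ^+ 2 / 2.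
Proof.
move=> sg Cx xv eta01; have := sg x v Cx xv eta eta01.
by rewrite /bregman /subopt [x + _ - x]addrAC subrr add0r dotZr !dotBr; lra.
Qed.

Lemma frank_wolfe_in C f (eta : nat -> R) (x v : nat -> 'rV[R]_n) :
  @convex_set R 'rV[R]_n C -> (forall t, 0 <= eta t <= 1) ->
  frank_wolfe C f eta x v -> forall t, C (x t).
Proof.
move=> cC eta01 [Cx0 fw]; elim=> // t IH; have [[Cv _] ->] := fw t.
exact: convex_set_segment.
Qed.

End Iterates.

Lemma subopt_rate (R : realType) (n : nat)
    (C U : set 'rV[R]_n) (f : 'rV[R]_n -> R)
    (l : nat) (M m r : R) (x v : nat -> 'rV[R]_n) (S : nat) :
  @convex_set R 'rV[R]_n C -> @convex_function R 'rV[R]_n C f ->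
  C `<=` U -> (forall y, U y -> differentiable f y) ->
  (1 <= l)%N -> 0 < M -> 0 < m -> 0 <= r -> r < 1 ->
  strong_growth0 C f M -> gaps_growth C f m r ->
  frank_wolfe C f (step R l) x v ->
  burn_in l M m r S -> forall t, (S <= t)%N ->
  subopt C f (x t) <= rate_bound C f x l M m r S t.
Proof.
move=> cC cf CU df l0 M0 m0 r0 r1 sg gg fw bS t St.
have eta01 s : 0 <= step R l s <= 1 by rewrite ltW ?step_gt0 ?step_le1.
have Cx := frank_wolfe_in cC eta01 fw.
have fx s : differentiable f (x s) by exact/df/CU.
have [_ xS] := fw.
apply: (@seq_rate R l S M m r (fun s => subopt C f (x s))
  (fun s => dot (grad f (x s)) (x s - v s))) => // s.
- exact: subopt_ge0 (xS s).1.
- exact: subopt_le_lmo (xS s).1.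
- by apply: le_trans (gg _ _) _ => //; exact: gap_le_lmo (xS s).1.
- by have [vs ->] := xS s; exact: subopt_descent.
Qed.

(** * The burn-in index and the asymptotic rate *)

Lemma max1_Rceil_nat (R : realType) (X : R) :
  exists k : nat, Num.max 1 (Rceil X) = k%:R.
Proof.
exists `|Num.max 1%R (Num.ceil X)|%N.
rewrite RceilE natr_absz ger0_norm ?le_max//.
by rewrite !maxEle -[1 in LHS]/(1%:~R) ler_int; case: ifP.
Qed.

(** An integer is at least X exactly when it is at least the ceiling of X, so the set is a final
    segment of the naturals. *)
Lemma is_minimum_ceil (R : realType) (X : R) (S : nat) :
  is_minimum [set i | (1 <= i)%N /\ X <= i%:R] S <->
  S%:R = Num.max 1 (Rceil X).
Proof.
rewrite RceilE.
have le_max_ceil i : ((1 <= i)%N /\ X <= i%:R) <->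
    Num.max 1 (Num.ceil X)%:~R <= i%:R :> R.
  rewrite ge_max ler1n (pmulrn 1 i) ler_int ceil_le_int.
  by split; [case=> -> ->|move/andP].
have [k kE] := max1_Rceil_nat X; rewrite RceilE in kE.
rewrite kE in le_max_ceil *; split => [[/le_max_ceil kS Smin]|/eqP].
  apply/eqP; rewrite eqr_nat eqn_leq; apply/andP; split; last by rewrite -(ler_nat R).
  by apply: Smin; apply/le_max_ceil.
rewrite eqr_nat => /eqP ->; split; first exact/le_max_ceil.
by move=> i /le_max_ceil; rewrite ler_nat.
Qed.

Lemma step_mul_le (R : realType) (l i : nat) (M k : R) :
  (0 < l)%N -> 0 < k ->
  (step R l i * M <= k^-1) = (k * (l%:R * M) - l%:R <= i%:R).
Proof.
move=> l0 k0; have l0' : 0 < l%:R :> R by rewrite ltr0n.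
have i0 : 0 <= i%:R :> R by [].
rewrite /step natrD -[k^-1]div1r ler_pdivlMr//; set N := i%:R + _.
have N0 : 0 < N by rewrite /N; lra.
have -> : l%:R / N * M * k = k * (l%:R * M) / N by field; lra.
by rewrite ler_pdivrMr// mul1r lerBlDr.
Qed.

Lemma is_minimum_threshold (R : realType) (X : R) (A : set nat) (S : nat) :
  (forall i, A i <-> (1 <= i)%N /\ X <= i%:R) ->
  is_minimum A S <-> S%:R%:E = maxe 1%E (er_map (@Rceil R) X%:E).
Proof.
move=> AE; rewrite (_ : A = [set i | (1 <= i)%N /\ X <= i%:R]); last first.
  by apply/seteqP; split => i /AE.
rewrite /= -EFin_max is_minimum_ceil.
by split => [->//|[]].
Qed.

Lemma burn_in_minimum (R : realType) (l : nat) (M m r : R) (S : nat) :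
  (0 < l)%N -> 0 < M -> 0 < m ->
  is_minimum (burn_in l M m r) S <-> S%:R%:E = burn_in_bound l M m r.
Proof.
move=> l0 M0 m0; have lM0 : 0 < l%:R * M by rewrite mulr_gt0 ?ltr0n.
rewrite /burn_in_bound /burn_in /root_ratio; case: eqP => [_|_]; last first.
  apply: is_minimum_threshold => i /=.
  rewrite lee_fin -[m `^ _ / _]invf_div step_mul_le//.
  by rewrite divr_gt0 ?powR_gt0.
(* Here r = 0. For [m < 2] the set is empty and the bound is [+oo]; for [m > 2] every [i >= 1]
   qualifies; for [m = 2] the ratio is 1. *)
case: (ltgtP m 2) => [m2|m2|_].
- rewrite gt0_mulye ?lte_fin// addye//=.
  rewrite max_r ?leey//; split => // -[[_] /=].
  by rewrite lee_fin leNgt mulr_gt0 ?step_gt0.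
- rewrite mul0e sub0e; apply: is_minimum_threshold => i /=.
  have : - l%:R <= i%:R :> R by rewrite (@le_trans _ _ 0)// oppr_le0.
  by move=> ->; rewrite leey.
- rewrite mul1e; apply: is_minimum_threshold => i /=.
  by rewrite lee_fin -[1 in X in X <-> _]invr1 step_mul_le// mul1r.
Qed.

Lemma burn_in_minimum_exists (R : realType) (l : nat) (M m r : R) :
  (0 < l)%N -> 0 < M -> 0 < m -> 0 < r ->
  exists S, is_minimum (burn_in l M m r) S.
Proof.
move=> l0 M0 m0 r0.
have [k kE] :=
  max1_Rceil_nat (2 `^ r^-1 / m `^ r^-1 * (l%:R * M) - l%:R).
exists k; apply/burn_in_minimum => //.
by rewrite /burn_in_bound /root_ratio gt_eqF//= -EFin_max kE.
Qed.

Lemma rate_bound_bigO (R : realType) (n : nat) (C : set 'rV[R]_n)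
    (f : 'rV[R]_n -> R) (x : nat -> 'rV[R]_n) (l : nat) (M m r : R) (S : nat) :
  (0 < l)%N -> 0 < M -> 0 < m -> r < 1 -> 0 <= subopt C f (x S) ->
  (fun t : nat => rate_bound C f x l M m r S t : R^o) =O_\oo
  (fun t : nat => t%:R ^- l + t%:R `^ (- (1 - r)^-1) + t%:R ^- 2 : R^o).
Proof.
move=> l0 M0 m0 r1 hS0; apply/eqO_exP.
have c0 : 0 < (M / m) `^ (1 - r)^-1 + M / 2.
  by rewrite ltr_wpDl ?powR_ge0 ?divr_gt0.
have l0' : 0 < l%:R :> R by rewrite ltr0n.
rewrite /rate_bound; set q := Num.min _ 2; set c := _ + M / 2 in c0 *.
(* Since [step R l t.-1 <= l / t], the two terms of the maximum are at most [K1 t^(-l)] and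
   [K2 t^(-q)]. *)
pose K1 := subopt C f (x S) * (l%:R / step R l S.-1) ^+ l.
pose K2 := l%:R `^ q * c.
have K10 : 0 <= K1 by rewrite mulr_ge0// exprn_ge0// divr_ge0 ?ltW ?step_gt0.
have K20 : 0 < K2 by rewrite mulr_gt0// powR_gt0.
have q0 : 0 <= q by rewrite !le_min ler0n invr_ge0 subr_ge0 (ltW r1) /=.
exists (K1 + K2); first by rewrite ltr_wpDl.
near=> t; have t0 : (0 < t)%N by near: t; exact: nbhs_infty_gt.
have t0' : 0 < t%:R :> R by rewrite ltr0n.
have s0 := step_gt0 R t.-1 l0; have S0 := step_gt0 R S.-1 l0.
have st : step R l t.-1 <= l%:R / t%:R.
  rewrite /step ler_pM2l// lef_pV2 ?posrE ?ltr0n ?addn_gt0 ?l0 ?orbT// ler_nat.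
  by rewrite -[X in (X <= _)%N](prednK t0) -addn1 leq_add2l.
have e1 : 0 <= t%:R ^- l :> R by rewrite invr_ge0 exprn_ge0.
have e2 : 0 <= t%:R `^ (- (1 - r)^-1) :> R by exact: powR_ge0.
have e3 : 0 <= t%:R ^- 2 :> R by rewrite invr_ge0 exprn_ge0.
rewrite !ger0_norm ?addr_ge0 ?le_max//; last first.
  by rewrite mulr_ge0// exprn_ge0// divr_ge0 ?(ltW s0) ?(ltW S0).
rewrite ge_max; apply/andP; split.
  apply: (@le_trans _ _ (K1 * t%:R ^- l)); last first.
    apply: ler_pM; rewrite ?ler_wpDr//; lra.
  rewrite /K1 -mulrA ler_wpM2l// -exprVn -exprMn; apply: lerXn2r.
  - by rewrite nnegrE divr_ge0 ?(ltW s0) ?(ltW S0).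
  - by rewrite nnegrE !mulr_ge0 ?invr_ge0 ?(ltW S0).
  - by rewrite [leRHS]mulrAC ler_wpM2r// invr_ge0 ltW.
apply: (@le_trans _ _ (K2 * t%:R `^ (- q))).
  have -> : K2 * t%:R `^ (- q) = (l%:R / t%:R) `^ q * c.
    rewrite /K2 powRM ?invr_ge0// mulrAC; congr (_ * _ * _).
    by rewrite -[X in X `^ q]powR_inv1// -powRrM mulN1r.
  rewrite ler_wpM2r ?(ltW c0)//; apply: ge0_ler_powR => //.
    by rewrite nnegrE ltW.
  by rewrite nnegrE divr_ge0.
apply: ler_pM; rewrite ?powR_ge0 ?(ltW K20) ?lerDr//.
have el : t%:R `^ (- l%:R) = t%:R ^- l :> R by rewrite powRN powR_mulrn.
have e2' : t%:R `^ (- 2) = t%:R ^- 2 :> R by rewrite powRN powR_mulrn.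
(* q is one of l, 1/(1-r), 2, so [t^(-q)] is one of the three summands. *)
rewrite /q; case: (leP (Num.min _ _) 2) => _; last by rewrite e2'; lra.
by case: (leP l%:R (1 - r)^-1) => _; rewrite ?el; lra.
Unshelve. all: by end_near.
Qed.

(** Existence of S is claimed for r > 0 only: for r = 0 and m < 2 the burn-in set is empty. *)
Theorem theorem5p1 (R : realType) (n : nat)
    (C U : set 'rV[R]_n) (f : 'rV[R]_n -> R)
    (l : nat) (M m r : R) (x v : nat -> 'rV[R]_n)
    (C_compact : compact C)
    (C_convex : @convex_set R 'rV[R]_n C)
    (f_convex : @convex_function R 'rV[R]_n C f)
    (U_open : open U) (C_sub_U : C `<=` U)
    (f_diff : forall y, U y -> differentiable f y)
    (l_ge1 : (1 <= l)%N)
    (M_gt0 : 0 < M) (m_gt0 : 0 < m) (r_ge0 : 0 <= r) (r_lt1 : r < 1)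
    (f_strong : strong_growth0 C f M)
    (f_gaps : gaps_growth C f m r)
    (x_fw : frank_wolfe C f (step R l) x v) :
  [/\ (0 < r -> exists S : nat, is_minimum (burn_in l M m r) S),
      (forall S : nat, is_minimum (burn_in l M m r) S <->
         S%:R%:E = burn_in_bound l M m r) &
      forall S : nat, is_minimum (burn_in l M m r) S ->
        (forall t : nat, (S <= t)%N ->
           subopt C f (x t) <= rate_bound C f x l M m r S t) /\
        (fun t : nat => rate_bound C f x l M m r S t : R^o) =O_\oo
        (fun t : nat => t%:R ^- l + t%:R `^ (- (1 - r)^-1) + t%:R ^- 2 : R^o)].
Proof.
have rate_le := subopt_rate C_convex f_convex C_sub_U f_diff l_ge1 M_gt0 m_gt0
  r_ge0 r_lt1 f_strong f_gaps x_fw.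
split=> [r_gt0|S|S [SB _]].
- exact: burn_in_minimum_exists.
- exact: burn_in_minimum.
- split; first exact: rate_le.
  apply: rate_bound_bigO => //.
  have step01 s : 0 <= step R l s <= 1 by rewrite ltW ?step_gt0 ?step_le1.
  have Cx := frank_wolfe_in C_convex step01 x_fw.
  by apply: subopt_ge0 f_convex _ (Cx S) (x_fw.2 S).1; exact/f_diff/C_sub_U.
Qed.
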